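(* Let $D\in\mathbb{R}^{n\times n}$ be symmetric and negative semi-definite and let $\lambda_{\min}<0$ be its smallest eigenvalue. Then a measure $\mu\in\mathcal{P}(\mathcal{S})$ maximizes $\mathcal{E}_D$ over $\mathcal{P}(\mathcal{S})$ if and only if $\mu=\frac12(\delta_z+\delta_{-z})$, where $z\in\mathcal{S}$ is an eigenvector of $D$ associated to $\lambda_{\min}$.
   Context: $\mathcal{S}=\{x\in\mathbb{R}^n:\|x\|=1\}$ is the Euclidean unit sphere, $\mathcal{P}(\mathcal{S})$ the set of Borel probability measures on $\mathcal{S}$, $\delta_z$ the Dirac measure at $z$, and $$\mathcal{E}_D(\mu)=\int_{\mathcal{S}}\int_{\mathcal{S}}e^{x\cdot Dy}\,d\mu(x)\,d\mu(y).$$ *)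

(* Defs.v *)
From HB Require Import structures.
From mathcomp Require Import all_boot all_order all_algebra.
From mathcomp Require Import all_classical all_reals all_analysis.

Set Implicit Arguments.
Unset Strict Implicit.
Unset Printing Implicit Defensive.

Import Order.TTheory GRing.Theory Num.Theory.
Import numFieldNormedType.Exports.

Local Open Scope classical_set_scope.
Local Open Scope ring_scope.

Definition dotp (R : realType) (n : nat) (x y : 'cV[R]_n) : R :=
  \sum_(i < n) x i 0 * y i 0.

(* The library norm `|x| on matrices is the sup norm, hence this definition. *)
Definition eucl_norm (R : realType) (n : nat) (x : 'cV[R]_n) : R :=
  Num.sqrt (dotp x x).

(* The unit sphere of R^(n+1): measurable types are pointed, hence nonempty,
   so the ambient dimension is written as a successor. *)
Definition unit_sphere (R : realType) (n : nat) : set 'cV[R]_n.+1 :=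
  [set x | eucl_norm x = 1].
Arguments unit_sphere : clear implicits.

Lemma unit_sphere_delta (R : realType) (n : nat) :
  delta_mx 0 0 \in unit_sphere R n.
Proof.
apply/mem_set; rewrite /unit_sphere /= /eucl_norm /dotp (bigD1 ord0) //=.
rewrite !mxE !eqxx mulr1 big1 ?addr0 ?sqrtr1 // => i i0.
by rewrite !mxE (negPf i0) mul0r.
Qed.

Lemma unit_sphereN (R : realType) (n : nat) (x : 'cV[R]_n.+1) :
  x \in unit_sphere R n -> - x \in unit_sphere R n.
Proof.
move=> /set_mem xS; apply/mem_set; rewrite /unit_sphere /= -[RHS]xS.
by rewrite /eucl_norm /dotp; under eq_bigr do rewrite !mxE mulrNN.
Qed.

Definition sphere (R : realType) (n : nat) : Type := set_type (unit_sphere R n).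

HB.instance Definition _ (R : realType) (n : nat) :=
  Topological.on (sphere R n).
HB.instance Definition _ (R : realType) (n : nat) :=
  isPointed.Build (sphere R n)
    (exist (fun x => x \in unit_sphere R n) _ (unit_sphere_delta R n)).

Definition sphere_val (R : realType) (n : nat) (x : sphere R n) : 'cV[R]_n.+1 :=
  set_val x.

Definition sphere_opp (R : realType) (n : nat) (x : sphere R n) : sphere R n :=
  exist (fun y => y \in unit_sphere R n) (- sphere_val x)
    (unit_sphereN (valP x)).

Definition borel_sphere (R : realType) (n : nat) :=
  g_sigma_algebraType (@open (sphere R n)).

HB.instance Definition _ (R : realType) (n : nat) :=
  Measurable.on (borel_sphere R n).

Definition energy (R : realType) (n : nat) (D : 'M[R]_n.+1)
    (mu : probability (borel_sphere R n) R) : \bar R :=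
  (\int[mu]_y \int[mu]_x
     (expR (dotp (sphere_val x) (D *m sphere_val y)))%:E)%E.

Definition maximizes_energy (R : realType) (n : nat) (D : 'M[R]_n.+1)
    (mu : probability (borel_sphere R n) R) : Prop :=
  forall nu : probability (borel_sphere R n) R,
    (energy D nu <= energy D mu)%E.

Definition neg_semidefinite (R : realType) (n : nat) (D : 'M[R]_n) : Prop :=
  forall x : 'cV[R]_n, dotp x (D *m x) <= 0.

(* [eigenvalue] refers to row vectors, v *m D = a *: v; a square matrix and its
   transpose have the same eigenvalues. *)
Definition smallest_eigenvalue (R : realType) (n : nat) (D : 'M[R]_n)
    (a : R) : Prop :=
  eigenvalue D a /\ forall b : R, eigenvalue D b -> a <= b.

Definition eigenvector (R : realType) (n : nat) (D : 'M[R]_n) (a : R)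
    (z : 'cV[R]_n) : Prop :=
  z != 0 /\ D *m z = a *: z.

(* Main.v *)
From HB Require Import structures.
Require Import Defs.
From mathcomp Require Import all_boot all_order all_algebra.
From mathcomp Require Import all_classical all_reals all_analysis.
From mathcomp Require Import measurable_realfun ring lra.

Import Order.TTheory GRing.Theory Num.Theory.
Import numFieldNormedType.Exports.

Local Open Scope classical_set_scope.
Local Open Scope ring_scope.

(** Put l = - lmin > 0. Applying Cauchy-Schwarz to the positive semidefinite
    form of - D and the Rayleigh bound lmin <= x . D x on the sphere, one gets
    |x . D y| <= l for unit vectors x and y ([nsd_form_bounded]). On [-l, l] the
    convex function exp lies below its chord
      s |-> cosh l + (sinh l / l) s,
    with equality only at the endpoints ([expR_le_chord]). Since the chord is
    affine, integrating it twice against mu only involves the barycenter m of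
    mu, whence
      energy mu + (integrated gap between the chord and exp)
        = cosh l + (sinh l / l) (m . D m) <= cosh l
    ([energy_add_defect]); the last step holds since m . D m <= 0. The value
    cosh l is attained by the mean of the Dirac masses at z and - z when z is an
    eigenvector for lmin ([energy_antipodal]), so it is the maximum.

    For a maximizer both nonnegative losses vanish. The vanishing gap gives a
    point z with |x . D z| = l for mu-almost every x ([energy_max_saturated]);
    the equality case of Cauchy-Schwarz then makes z an eigenvector for lmin and
    forces x = z or x = - z ([nsd_form_extremal]). From m . D m = 0 and
    semidefiniteness, D m = 0, so m is orthogonal to z, and the two atoms carry
    the same mass ([ae_antipodal_balanced]). *)

Set Implicit Arguments.
Unset Strict Implicit.
Unset Printing Implicit Defensive.

(** * The Euclidean product and semidefinite forms *)

Lemma dotpE (R : realType) n (x y : 'cV[R]_n) : dotp x y = (x^T *m y) 0 0.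
Proof. by rewrite /dotp mxE; apply: eq_bigr => i _; rewrite mxE. Qed.

Lemma dotpC (R : realType) n (x y : 'cV[R]_n) : dotp x y = dotp y x.
Proof. by apply: eq_bigr => i _; rewrite mulrC. Qed.

Lemma dotpDl (R : realType) n (x y z : 'cV[R]_n) :
  dotp (x + y) z = dotp x z + dotp y z.
Proof. by rewrite !dotpE linearD /= mulmxDl mxE. Qed.

Lemma dotpZl (R : realType) n a (x y : 'cV[R]_n) :
  dotp (a *: x) y = a * dotp x y.
Proof. by rewrite !dotpE linearZ /= -scalemxAl mxE. Qed.

Lemma dotpDr (R : realType) n (x y z : 'cV[R]_n) :
  dotp x (y + z) = dotp x y + dotp x z.
Proof. by rewrite dotpC dotpDl !(dotpC x). Qed.

Lemma dotpZr (R : realType) n a (x y : 'cV[R]_n) :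
  dotp x (a *: y) = a * dotp x y.
Proof. by rewrite dotpC dotpZl dotpC. Qed.

Lemma dotpNl (R : realType) n (x y : 'cV[R]_n) : dotp (- x) y = - dotp x y.
Proof. by rewrite -scaleN1r dotpZl mulN1r. Qed.

Lemma dotpNr (R : realType) n (x y : 'cV[R]_n) : dotp x (- y) = - dotp x y.
Proof. by rewrite dotpC dotpNl dotpC. Qed.

Lemma dotp0 (R : realType) n (x : 'cV[R]_n) : dotp x 0 = 0.
Proof. by rewrite -(scale0r 0) dotpZr mul0r. Qed.

Lemma dotp_ge0 (R : realType) n (x : 'cV[R]_n) : 0 <= dotp x x.
Proof. by apply: sumr_ge0 => i _; rewrite -expr2 sqr_ge0. Qed.

Lemma dotp_eq0 (R : realType) n (x : 'cV[R]_n) : (dotp x x == 0) = (x == 0).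
Proof.
apply/eqP/eqP => [x0|->]; last exact: dotp0.
apply/matrixP => i j; rewrite ord1 mxE; apply/eqP; rewrite -sqrf_eq0 expr2.
apply/eqP; apply: psumr_eq0P x0 i _ => // k _; by rewrite -expr2 sqr_ge0.
Qed.

Lemma dotp_sym (R : realType) n (B : 'M[R]_n) (x y : 'cV[R]_n) :
  B^T = B -> dotp x (B *m y) = dotp y (B *m x).
Proof.
by move=> sB; rewrite (dotpC y) !dotpE trmx_mul sB mulmxA.
Qed.

Definition pos_semidefinite (R : realType) n (B : 'M[R]_n) :=
  forall x : 'cV[R]_n, 0 <= dotp x (B *m x).

(** The form is nonnegative at every combination t x + s y, so its discriminant
    is nonpositive. *)
Lemma psd_cauchy_schwarz (R : realType) n (B : 'M[R]_n) (x y : 'cV[R]_n) :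
  B^T = B -> pos_semidefinite B ->
  dotp x (B *m y) ^+ 2 <= dotp x (B *m x) * dotp y (B *m y).
Proof.
move=> sB pB; set a := dotp x (B *m x); set b := dotp x _; set c := dotp y _.
have q t s : 0 <= t ^+ 2 * a + 2 * t * s * b + s ^+ 2 * c.
  have := pB (t *: x + s *: y); rewrite mulmxDr -!scalemxAr.
  rewrite !(dotpDl, dotpDr, dotpZl, dotpZr) (dotp_sym y x sB) -/a -/b -/c.
  by congr (_ <= _); ring.
have : 0 <= a by exact: pB.
rewrite le_eqVlt => /orP[/eqP a0|a0]; last first.
  (* proportional to (- b / a, 1), the minimizer at s = 1 *)
  have := q b (- a); have -> : b ^+ 2 * a + 2 * b * - a * b + (- a) ^+ 2 * c =
    a * (a * c - b ^+ 2) by ring.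
  by rewrite pmulr_rge0 // subr_ge0.
rewrite -a0 mul0r; have [->|b0] := eqVneq b 0; first by rewrite expr0n.
(* with a = 0 the form is affine in t; this t makes it equal to -1 *)
have := q (- (c + 1) / (2 * b)) 1.
rewrite -a0; have -> : (- (c + 1) / (2 * b)) ^+ 2 * 0 +
  2 * (- (c + 1) / (2 * b)) * 1 * b + 1 ^+ 2 * c = -1 by field.
lra.
Qed.

(** Cauchy-Schwarz against the test vector B y. *)
Lemma psd_isotropic_ker (R : realType) n (B : 'M[R]_n) (y : 'cV[R]_n) :
  B^T = B -> pos_semidefinite B -> dotp y (B *m y) = 0 -> B *m y = 0.
Proof.
move=> sB pB y0; have := psd_cauchy_schwarz (B *m y) y sB pB.
rewrite y0 mulr0 => h; apply/eqP; rewrite -dotp_eq0 -sqrf_eq0.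
by rewrite eq_le h sqr_ge0.
Qed.

Lemma nsd_opp_psd (R : realType) n (D : 'M[R]_n) :
  neg_semidefinite D -> pos_semidefinite (- D).
Proof. by move=> nD x; rewrite mulNmx dotpNr oppr_ge0; exact: nD. Qed.

Lemma nsd_cauchy_schwarz (R : realType) n (D : 'M[R]_n) (x y : 'cV[R]_n) :
  D^T = D -> neg_semidefinite D ->
  dotp x (D *m y) ^+ 2 <= dotp x (D *m x) * dotp y (D *m y).
Proof.
move=> sD nD; have sN : (- D)^T = - D by rewrite linearN /= sD.
have := psd_cauchy_schwarz x y sN (nsd_opp_psd nD).
by rewrite !mulNmx !dotpNr sqrrN mulrNN.
Qed.

Lemma quadratic_form_bounded (R : realType) n (M : 'M[R]_n) :
  exists2 C, 0 < C & forall x : 'cV[R]_n, dotp x (M *m x) <= C * dotp x x.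
Proof.
exists (1 + \sum_i \sum_j `|M i j|) => [|x].
  by rewrite ltr_pwDl // sumr_ge0 // => i _; apply: sumr_ge0.
have sq i : x i 0 ^+ 2 <= dotp x x.
  rewrite /dotp (bigD1 i) //= -expr2 lerDl sumr_ge0 // => j _.
  by rewrite -expr2 sqr_ge0.
rewrite mulrDl mul1r -[leLHS]add0r lerD ?dotp_ge0 // mulr_suml.
apply: ler_sum => i _; rewrite mxE mulr_sumr mulr_suml.
apply: ler_sum => j _; apply: le_trans (ler_norm _) _.
rewrite mulrCA normrM ler_wpM2l //.
have := sq i; have := sq j; rewrite ler_norml.
have := sqr_ge0 (x i 0 + x j 0); have := sqr_ge0 (x i 0 - x j 0).
by move=> *; apply/andP; split; nra.
Qed.

(** Compactness-free coercivity: writing x = B y with y = B^-1 x, Cauchy-Schwarz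
    for the form of B gives (x . x)^2 <= (x . B x) (x . B^-1 x), and the second
    factor is at most C (x . x). *)
Lemma psd_unit_coercive (R : realType) n (B : 'M[R]_n) :
  B^T = B -> pos_semidefinite B -> B \in unitmx ->
  exists2 e, 0 < e & forall x : 'cV[R]_n, e * dotp x x <= dotp x (B *m x).
Proof.
move=> sB pB uB; have [C C0 hC] := quadratic_form_bounded (invmx B).
exists C^-1 => [|x]; first by rewrite invr_gt0.
have := dotp_ge0 x; rewrite le_eqVlt => /orP[/eqP<-|x0]; first by rewrite mulr0.
rewrite ler_pdivrMl // -(ler_pM2r x0).
have := psd_cauchy_schwarz x (invmx B *m x) sB pB.
rewrite mulKVmx // (dotpC (invmx B *m x)) expr2 => /le_trans; apply.
by rewrite [C * _]mulrC -mulrA ler_wpM2l.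
Qed.

(** The largest t such that D - t is positive semidefinite is an eigenvalue of
    D: otherwise D - t would be invertible, hence coercive, and t could be
    increased. That t is therefore at least the smallest eigenvalue. *)
Lemma smallest_eigenvalue_rayleigh (R : realType) n (D : 'M[R]_n.+1) a
    (x : 'cV[R]_n.+1) :
  D^T = D -> smallest_eigenvalue D a -> a * dotp x x <= dotp x (D *m x).
Proof.
move=> sD [_ amin].
pose S := [set t : R | forall y : 'cV[R]_n.+1, t * dotp y y <= dotp y (D *m y)].
have supS : has_sup S.
  split.
    have [C _ hC] := quadratic_form_bounded (- D); exists (- C) => y.
    by have := hC y; rewrite mulNmx dotpNr mulNr lerNl.
  pose d : 'cV[R]_n.+1 := delta_mx 0 0.
  exists (dotp d (D *m d)) => t /(_ d); suff -> : dotp d d = 1 by rewrite mulr1.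
  by rewrite dotpE trmx_delta mul_delta_mx mxE !eqxx.
have SsupS : S (sup S).
  move=> y; have := dotp_ge0 y; rewrite le_eqVlt => /orP[/eqP y0|y0].
    move/esym/eqP: y0; rewrite dotp_eq0 => /eqP ->.
    by rewrite mulmx0 !dotp0 mulr0.
  rewrite -ler_pdivlMr //; apply: ge_sup => [|t St]; first by case: supS.
  by rewrite ler_pdivlMr //; exact: St.
suff eigS : eigenvalue D (sup S).
  by apply: le_trans (SsupS x); rewrite ler_wpM2r ?dotp_ge0 ?amin.
have [//|neig] := boolP (eigenvalue D (sup S)).
pose B := D - (sup S)%:M.
have Bq y : dotp y (B *m y) = dotp y (D *m y) - sup S * dotp y y.
  by rewrite mulmxBl mul_scalar_mx dotpDr dotpNr dotpZr.
have [|||e e0 he] := @psd_unit_coercive _ _ B.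
- by rewrite linearB /= sD tr_scalar_mx.
- by move=> y; rewrite Bq subr_ge0.
- by rewrite -row_free_unit -kermx_eq0; exact: negbNE neig.
have : S (sup S + e) by move=> y; have := he y; rewrite Bq; lra.
by move/(ub_le_sup (proj2 supS)); rewrite gerDl leNgt e0.
Qed.

(** * Semidefinite forms on the sphere *)

Lemma dotp_sphere (R : realType) n (x : sphere R n) :
  dotp (sphere_val x) (sphere_val x) = 1.
Proof.
have /set_mem := valP x; rewrite /unit_sphere /= /eucl_norm => x1.
by rewrite -[LHS]sqr_sqrtr ?dotp_ge0 // x1 expr1n.
Qed.

Lemma sphere_coord_le1 (R : realType) n (x : sphere R n) i :
  `|sphere_val x i 0| <= 1.
Proof.
rewrite -(@ler_pXn2r _ 2) ?nnegrE // expr1n real_normK ?num_real //.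
rewrite -(dotp_sphere x) /dotp (bigD1 i) //= -expr2 lerDl.
by apply: sumr_ge0 => j _; rewrite -expr2 sqr_ge0.
Qed.

Lemma nsd_form_bounded (R : realType) n (D : 'M[R]_n.+1) lmin
    (x y : sphere R n) :
  D^T = D -> neg_semidefinite D -> smallest_eigenvalue D lmin ->
  `|dotp (sphere_val x) (D *m sphere_val y)| <= - lmin.
Proof.
move=> sD nD eD.
have ray (u : sphere R n) : lmin <= dotp (sphere_val u) (D *m sphere_val u).
  by have := smallest_eigenvalue_rayleigh (sphere_val u) sD eD;
    rewrite dotp_sphere mulr1.
have l0 : 0 <= - lmin by rewrite oppr_ge0 (le_trans (ray x)) ?nD.
rewrite -(@ler_pXn2r _ 2) ?nnegrE // real_normK ?num_real //.
apply: le_trans (nsd_cauchy_schwarz _ _ sD nD) _.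
by rewrite -mulrNN expr2 ler_pM ?oppr_ge0 ?lerN2.
Qed.

(** Equality in the previous bound makes y a minimizer of the Rayleigh quotient,
    hence an isotropic vector of the positive semidefinite matrix D - lmin, so
    D y = lmin y. Then |x . y| = 1, and one of x - y, x + y has norm 0. *)
Lemma nsd_form_extremal (R : realType) n (D : 'M[R]_n.+1) lmin
    (x y : sphere R n) :
  D^T = D -> neg_semidefinite D -> smallest_eigenvalue D lmin -> lmin < 0 ->
  `|dotp (sphere_val x) (D *m sphere_val y)| = - lmin ->
  eigenvector D lmin (sphere_val y) /\ (x = y \/ x = sphere_opp y).
Proof.
move=> sD nD eD l0 xy.
have ray u := smallest_eigenvalue_rayleigh u sD eD.
have yy : dotp (sphere_val y) (D *m sphere_val y) = lmin.
  have := nsd_cauchy_schwarz (sphere_val x) (sphere_val y) sD nD.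
  rewrite -real_normK ?num_real // xy.
  have := nD (sphere_val x); have := nD (sphere_val y).
  have := ray (sphere_val x); have := ray (sphere_val y).
  rewrite !dotp_sphere !mulr1.
  set a := dotp _ _; set b := dotp _ _ => la lb a0 b0 h.
  by apply/eqP; rewrite eq_le la andbT; nra.
have Dy : D *m sphere_val y = lmin *: sphere_val y.
  apply/eqP; rewrite -subr_eq0 -mul_scalar_mx -mulmxBl; apply/eqP.
  apply: psd_isotropic_ker.
  - by rewrite linearB /= sD tr_scalar_mx.
  - move=> u; rewrite mulmxBl mul_scalar_mx dotpDr dotpNr dotpZr subr_ge0.
    exact: ray.
  - by rewrite mulmxBl mul_scalar_mx dotpDr dotpNr dotpZr yy dotp_sphere mulr1
      subrr.
split.
  split => //; rewrite -dotp_eq0 dotp_sphere; exact: oner_neq0.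
have xy1 : `|dotp (sphere_val x) (sphere_val y)| = 1.
  move: xy; rewrite Dy dotpZr normrM ltr0_norm //.
  move=> /(congr1 ( *%R (- lmin)^-1)).
  by rewrite mulKf ?mulVf // oppr_eq0 lt_eqF.
move: xy1; case: (ger0P (dotp (sphere_val x) _)) => _ xy1; [left|right].
  apply: val_inj; apply/eqP; rewrite -subr_eq0 -dotp_eq0; apply/eqP.
  rewrite -!/(sphere_val _) !(dotpDl, dotpDr, dotpNl, dotpNr).
  rewrite !dotp_sphere (dotpC (sphere_val y)) xy1; lra.
apply: val_inj; apply/eqP; rewrite -subr_eq0 -dotp_eq0 /= opprK; apply/eqP.
rewrite -!/(sphere_val _) !(dotpDl, dotpDr) !dotp_sphere.
by rewrite (dotpC (sphere_val y)); lra.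
Qed.

Lemma unit_eigenvector_exists (R : realType) n (D : 'M[R]_n.+1) a :
  D^T = D -> eigenvalue D a ->
  exists z : sphere R n, eigenvector D a (sphere_val z).
Proof.
move=> sD /eigenvalueP[v vD v0]; pose u := v^T.
have u0 : u != 0 by rewrite trmx_eq0.
have uu : 0 < dotp u u by rewrite lt_def dotp_eq0 u0 dotp_ge0.
pose w := (Num.sqrt (dotp u u))^-1 *: u.
have w1 : w \in unit_sphere R n.
  apply/mem_set; rewrite /unit_sphere /= /eucl_norm dotpZl dotpZr mulrA -expr2.
  by rewrite exprVn sqr_sqrtr ?ltW // mulVf ?gt_eqF // sqrtr1.
exists (exist _ w w1); split.
  by rewrite scaler_eq0 negb_or u0 andbT invr_eq0 sqrtr_eq0 -ltNge.
rewrite /sphere_val /= -scalemxAr scalerA mulrC -scalerA; congr (_ *: _).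
by rewrite /u -{1}sD -trmx_mul vD linearZ.
Qed.

(** * The exponential and its chord *)

Definition cosh (R : realType) (l : R) := (expR l + expR (- l)) / 2.

(** This is sinh l / l. *)
Definition chord_slope (R : realType) (l : R) :=
  (expR l - expR (- l)) / (2 * l).

(** The line through the graph of exp at - l and l. *)
Definition chord (R : realType) (l s : R) := cosh l + chord_slope l * s.

(** Strict convexity of exp, from its tangent lines: s is the convex combination
    of l and - l with weights (l + s) / (2 l) and (l - s) / (2 l); combining
    with these weights the tangent line at s evaluated at l and - l returns exp s. *)
Lemma expR_le_chord (R : realType) (l s : R) : 0 < l -> `|s| <= l ->
  expR s <= chord l s ?= iff (`|s| == l).
Proof.
move=> l0 sl.
have chE : chord l s = ((l + s) * expR l + (l - s) * expR (- l)) / (2 * l).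
  by rewrite /chord /cosh /chord_slope; field; rewrite gt_eqF.
have tangent t : expR s * (1 + (t - s)) <= expR t ?= iff (t == s).
  have -> : expR t = expR s * expR (t - s) by rewrite -expRD addrC subrK.
  split; first by rewrite ler_pM2l ?expR_gt0 // expR_ge1Dx.
  rewrite (inj_eq (mulfI (lt0r_neq0 (expR_gt0 s)))).
  have [->|ts] := eqVneq t s; first by rewrite subrr addr0 expR0 eqxx.
  by rewrite lt_eqF // expR_gt1Dx // subr_eq0.
have sE : expR s = ((l + s) * (expR s * (1 + (l - s))) +
    (l - s) * (expR s * (1 + (- l - s)))) / (2 * l).
  by field; rewrite gt_eqF.
have /andP[sl1 sl2] : - l <= s <= l by rewrite -ler_norml.
have [e|ne] := eqVneq `|s| l.
  split; last first.
    move: e; case: (ger0P s) => _ e; apply/eqP; rewrite chE.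
      by rewrite e; field; rewrite -e gt_eqF // e.
    have -> : s = - l by rewrite -e opprK.
    by rewrite addrN mul0r add0r; field; rewrite gt_eqF.
  rewrite chE [leLHS]sE ler_pM2r ?invr_gt0; last lra.
  by apply: lerD; apply: ler_wpM2l; rewrite ?subr_ge0 ?(tangent _).1 //; lra.
have slt : `|s| < l by rewrite lt_neqAle ne.
have {sl1 sl2}/andP[sl1 sl2] : - l < s < l by rewrite -ltr_norml.
suff h : expR s < chord l s by split; [exact: ltW|rewrite lt_eqF].
rewrite chE [ltLHS]sE ltr_pM2r ?invr_gt0; last lra.
apply: ltrD; rewrite ltr_pM2l; [|lra| |lra];
  by rewrite (lt_leif (tangent _)); apply/negP => /eqP; lra.
Qed.

Lemma chord_slope_gt0 (R : realType) (l : R) : 0 < l -> 0 < chord_slope l.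
Proof.
by move=> l0; rewrite divr_gt0 ?mulr_gt0 // subr_gt0 ltr_expR; lra.
Qed.

(** * Probability measures *)

Lemma ae_ex d (T : measurableType d) (R : realType) (P : probability T R)
    (Q : T -> Prop) : (\forall x \ae P, Q x) -> exists x, Q x.
Proof.
move=> [A [mA A0 QA]]; apply: contrapT => nQ.
have := probability_setT P; suff -> : setT = A.
  move=> A1; have [/eqP] := etrans (esym A1) A0.
  by rewrite oner_eq0.
by apply/seteqP; split => // x _; apply: QA => Qx; apply: nQ; exists x.
Qed.

Lemma ge0_integral_eq0_ae d (T : measurableType d) (R : realType)
    (mu : {measure set T -> \bar R}) (f : T -> \bar R) :
  measurable_fun setT f -> (forall x, (0 <= f x)%E) ->
  (\int[mu]_x f x = 0)%E -> \forall x \ae mu, f x = 0%E.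
Proof.
move=> mf f0 If; have := (ae_eq_integral_abs mu measurableT mf).1.
under eq_integral do rewrite gee0_abs //.
by move=> /(_ If); apply: filterS => x; exact.
Qed.

Lemma probability_bounded_integrable d (T : measurableType d) (R : realType)
    (P : probability T R) (f : T -> R) (C : R) :
  measurable_fun setT f -> (forall x, `|f x| <= C) ->
  P.-integrable setT (fun x => (f x)%:E).
Proof.
move=> mf fC; apply: (@measurable_bounded_integrable _ _ _ _ f) => //.
  exact: fin_num_fun_lty.
exists C; split; first exact: num_real.
by move=> M CM x _; exact: le_trans (fC x) (ltW CM).
Qed.

(** * Measurability on the sphere *)

Lemma measurable_dotp d (T : measurableType d) (R : realType) n
    (f g : T -> 'cV[R]_n) :
  (forall i, measurable_fun setT (fun t => f t i 0)) ->
  (forall i, measurable_fun setT (fun t => g t i 0)) ->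
  measurable_fun setT (fun t => dotp (f t) (g t)).
Proof. by move=> mf mg; apply: measurable_sum => i; exact: measurable_funM. Qed.

Lemma measurable_mulmx_coord d (T : measurableType d) (R : realType) m n
    (D : 'M[R]_(m, n)) (f : T -> 'cV[R]_n) :
  (forall i, measurable_fun setT (fun t => f t i 0)) ->
  forall i, measurable_fun setT (fun t => (D *m f t) i 0).
Proof.
move=> mf i; rewrite (_ : (fun _ => _) = fun t => \sum_j D i j * f t j 0).
  by apply: measurable_sum => j; exact: measurable_funM.
by apply/funext => t; rewrite mxE.
Qed.

(** The topology of the sphere is induced by the inclusion, so coordinates are
    continuous, hence Borel. *)
Lemma measurable_sphere_coord (R : realType) n i :
  measurable_fun setT (fun x : borel_sphere R n => sphere_val x i 0).
Proof.
apply: (measurability _ (RGenOpens.measurableE R)) => _ [_ [a [b ->] <-]].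
rewrite setTI; apply: sub_sigma_algebra.
suff : continuous (fun x : sphere R n => sphere_val x i 0).
  by move=> /continuousP cf; exact/cf/interval_open.
move=> x; apply: (@continuous_comp _ _ _ (@sphere_val R n) (fun M => M i 0)).
  exact: initial_continuous.
exact: coord_continuous.
Qed.

(** By Tonelli, joint measurability makes the inner integrals measurable. *)
Lemma measurable_form (R : realType) n (D : 'M[R]_n.+1) :
  measurable_fun setT (fun p : borel_sphere R n * borel_sphere R n =>
    dotp (sphere_val p.1) (D *m sphere_val p.2)).
Proof.
apply: measurable_dotp => [i|]; last apply: measurable_mulmx_coord => i.
  exact: (measurableT_comp (measurable_sphere_coord i) measurable_fst).
exact: (measurableT_comp (measurable_sphere_coord i) measurable_snd).
Qed.

Lemma measurable_linear (R : realType) n (v : 'cV[R]_n.+1) :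
  measurable_fun setT (fun x : borel_sphere R n => dotp (sphere_val x) v).
Proof.
apply: measurable_dotp => i; first exact: measurable_sphere_coord.
exact: measurable_cst.
Qed.

(** * Barycenters *)

Section barycenter.
Context (R : realType) (n : nat) (mu : probability (borel_sphere R n) R).

Definition barycenter : 'cV[R]_n.+1 :=
  \col_i (\int[mu]_x sphere_val x i 0).

Lemma integrable_sphere_coord i :
  mu.-integrable setT (fun x => (sphere_val x i 0)%:E).
Proof.
apply: (@probability_bounded_integrable _ _ _ mu _ 1).
  exact: measurable_sphere_coord.
by move=> x; exact: sphere_coord_le1.
Qed.

Lemma integral_affine (a b : R) (v : 'cV[R]_n.+1) :
  (\int[mu]_x (a + b * dotp (sphere_val x) v)%:E =
   (a + b * dotp barycenter v)%:E)%E.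
Proof.
have int_coord i : mu.-integrable setT
    (fun x => (b * v i 0)%:E * (sphere_val x i 0)%:E)%E.
  by apply: integrableZl => //; exact: integrable_sphere_coord.
have affE x : (a + b * dotp (sphere_val x) v)%:E =
    (cst a%:E x + \sum_i (b * v i 0)%:E * (sphere_val x i 0)%:E)%E.
  rewrite EFinD /dotp mulr_sumr -sumEFin; congr (_ + _)%E.
  by apply: eq_bigr => i _; rewrite -EFinM; congr EFin; ring.
under eq_integral do rewrite affE.
rewrite integralD //=; last 2 first.
- exact: finite_measure_integrable_cst.
- exact: integrable_sum.
have -> : (\int[mu]_x cst a%:E x = a%:E)%E.
  rewrite integral_cst // -[RHS]mule1; congr (_ * _)%E; exact: probability_setT.
rewrite integral_sum //.
rewrite EFinD /dotp mulr_sumr -sumEFin; congr (_ + _)%E.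
apply: eq_bigr => i _.
rewrite integralZl //; last exact: integrable_sphere_coord.
rewrite mxE /Rintegral -[X in (_ * X)%E = _]fineK -?EFinM; last first.
  by apply: integrable_fin_num => //; exact: integrable_sphere_coord.
by congr EFin; ring.
Qed.

End barycenter.

(** * The energy bound and its equality case *)

Section energy_defect.
Context (R : realType) (n : nat) (D : 'M[R]_n.+1) (l : R).
Hypotheses (l_gt0 : 0 < l) (D_sym : D^T = D).
Hypothesis D_bound : forall x y : sphere R n,
  `|dotp (sphere_val x) (D *m sphere_val y)| <= l.
Variable mu : probability (borel_sphere R n) R.

Let defect (x y : sphere R n) : R :=
  let s := dotp (sphere_val x) (D *m sphere_val y) in chord l s - expR s.

Let defect_ge0 x y : 0 <= defect x y.
Proof. by rewrite subr_ge0 (expR_le_chord l_gt0 (D_bound x y)).1. Qed.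

Let measurable_form_comp (h : R -> R) : measurable_fun setT h ->
  measurable_fun setT (fun p : borel_sphere R n * borel_sphere R n =>
    (h (dotp (sphere_val p.1) (D *m sphere_val p.2)))%:E).
Proof.
move=> mh; apply/measurable_EFinP.
exact: (measurableT_comp mh (measurable_form D)).
Qed.

Let measurable_gap : measurable_fun setT (fun s : R => chord l s - expR s).
Proof.
by apply: measurable_funB => //; exact: measurable_funD.
Qed.

Let measurable_inner (h : R -> R) : measurable_fun setT h ->
  (forall x y, 0 <= h (dotp (sphere_val x) (D *m sphere_val y))) ->
  measurable_fun setT (fun y : borel_sphere R n =>
    (\int[mu]_x (h (dotp (sphere_val x) (D *m sphere_val y)))%:E)%E).
Proof.
move=> mh h0.
apply: (measurable_fun_fubini_tonelli_G (m1 := mu) _ (measurable_form_comp mh)).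
by move=> p; rewrite lee_fin.
Qed.

Let measurable_section (h : R -> R) (y : sphere R n) : measurable_fun setT h ->
  measurable_fun setT (fun x : borel_sphere R n =>
    (h (dotp (sphere_val x) (D *m sphere_val y)))%:E).
Proof.
move=> mh; apply/measurable_EFinP.
exact: (measurableT_comp mh (measurable_linear _)).
Qed.

(** The inner integrals of exp and of the gap add up to the integral of the
    chord, an affine function of x, which replaces x by the barycenter; the outer
    integral does the same for y, D being symmetric. *)
Lemma energy_add_defect :
  (energy D mu + \int[mu]_y \int[mu]_x (defect x y)%:E =
   (chord l (dotp (barycenter mu) (D *m barycenter mu)))%:E)%E.
Proof.
rewrite /energy -ge0_integralD //; first last.
- exact: (measurable_inner measurable_gap).
- by move=> y _; apply: integral_ge0 => x _; rewrite lee_fin.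
- apply: (measurable_inner (@measurable_expR R)) => x y; exact: expR_ge0.
- by move=> y _; apply: integral_ge0 => x _; rewrite lee_fin expR_ge0.
have innerE (y : borel_sphere R n) :
    (\int[mu]_x (expR (dotp (sphere_val x) (D *m sphere_val y)))%:E +
     \int[mu]_x (defect x y)%:E =
     (chord l (dotp (sphere_val y) (D *m barycenter mu)))%:E)%E.
  rewrite -ge0_integralD //; first last.
  - exact: (measurable_section _ measurable_gap).
  - by move=> x _; rewrite lee_fin.
  - exact: (measurable_section _ (@measurable_expR R)).
  under eq_integral do rewrite -EFinD addrC subrK.
  by rewrite integral_affine (dotp_sym _ _ D_sym).
under eq_integral do rewrite innerE.
exact: integral_affine.
Qed.

Hypothesis D_nsd : neg_semidefinite D.

Lemma chord_barycenter_le :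
  chord l (dotp (barycenter mu) (D *m barycenter mu)) <= cosh l.
Proof.
by rewrite gerDl pmulr_rle0 ?chord_slope_gt0.
Qed.

Lemma energy_le_cosh : (energy D mu <= (cosh l)%:E)%E.
Proof.
apply: (@le_trans _ _ (chord l (dotp (barycenter mu) (D *m barycenter mu)))%:E).
  rewrite -energy_add_defect leeDl // integral_ge0 // => y _.
  by apply: integral_ge0 => x _; rewrite lee_fin.
by rewrite lee_fin chord_barycenter_le.
Qed.

(** The two losses in the bound by cosh l are nonnegative, so each is zero. *)
Lemma energy_max_tight : ((cosh l)%:E <= energy D mu)%E ->
  dotp (barycenter mu) (D *m barycenter mu) = 0 /\
  (\int[mu]_y \int[mu]_x (defect x y)%:E = 0)%E.
Proof.
move=> maxE; have EI := energy_add_defect; have cm := chord_barycenter_le.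
have : (0 <= \int[mu]_y \int[mu]_x (defect x y)%:E)%E.
  by apply: integral_ge0 => y _; apply: integral_ge0 => x _; rewrite lee_fin.
have E0 : energy D mu = (cosh l)%:E.
  by apply/eqP; rewrite eq_le energy_le_cosh maxE.
move: EI; rewrite E0; case: (X in (_ + X)%E) => // r [EI].
rewrite lee_fin => r0.
have r00 : r = 0 by lra.
split; last by rewrite r00.
have cs : chord_slope l * dotp (barycenter mu) (D *m barycenter mu) = 0.
  by move: EI; rewrite r00 /chord; lra.
by move/eqP: cs; rewrite mulf_eq0 gt_eqF ?chord_slope_gt0 // => /eqP.
Qed.

Lemma energy_max_barycenter : ((cosh l)%:E <= energy D mu)%E ->
  D *m barycenter mu = 0.
Proof.
move=> /energy_max_tight[m0 _]; apply: oppr_inj; rewrite oppr0 -mulNmx.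
apply: psd_isotropic_ker; first by rewrite linearN /= D_sym.
  by move=> u; rewrite mulNmx dotpNr oppr_ge0; exact: D_nsd.
by rewrite mulNmx dotpNr m0 oppr0.
Qed.

(** The gap has zero integral, so some section of it vanishes almost everywhere;
    exp meets its chord only at the endpoints. *)
Lemma energy_max_saturated : ((cosh l)%:E <= energy D mu)%E ->
  exists z : sphere R n, \forall x \ae mu,
    `|dotp (sphere_val x) (D *m sphere_val z)| = l.
Proof.
move=> /energy_max_tight[_ I0].
have inner0 (y : borel_sphere R n) : (0 <= \int[mu]_x (defect x y)%:E)%E.
  by apply: integral_ge0 => x _; rewrite lee_fin.
have /ae_ex[z z0] :=
  ge0_integral_eq0_ae (measurable_inner measurable_gap defect_ge0) inner0 I0.
exists z; have sec0 (x : borel_sphere R n) : (0 <= (defect x z)%:E)%E.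
  by rewrite lee_fin.
have := ge0_integral_eq0_ae (measurable_section z measurable_gap) sec0 z0.
apply: filterS => x [] /eqP; rewrite subr_eq0 eq_sym => /eqP/eqP.
by rewrite (expR_le_chord l_gt0 (D_bound x z)).2 => /eqP.
Qed.

End energy_defect.

(** * Antipodal pairs of atoms *)

Section antipodal.
Context (R : realType) (n : nat) (z : sphere R n).

Definition antipodal : set (borel_sphere R n) -> \bar R :=
  mscale (2^-1)%:nng (measure_add (dirac (z : borel_sphere R n))
                                  (dirac (sphere_opp z : borel_sphere R n))).

HB.instance Definition _ := Measure.on antipodal.

Lemma antipodalE A : antipodal A =
  ((2^-1)%:E * (dirac (z : borel_sphere R n) A +
                dirac (sphere_opp z : borel_sphere R n) A))%E.
Proof. by rewrite -measure_addE. Qed.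

Let antipodal_setT : antipodal setT = 1%E.
Proof.
by rewrite antipodalE !diracT -EFinD -EFinM; congr EFin; rewrite mulVf.
Qed.

HB.instance Definition _ :=
  Measure_isProbability.Build _ _ _ antipodal antipodal_setT.

Lemma ge0_integral_antipodal (f : borel_sphere R n -> R) :
  measurable_fun setT f -> (forall x, 0 <= f x) ->
  (\int[antipodal]_x (f x)%:E = ((f z + f (sphere_opp z)) / 2)%:E)%E.
Proof.
move=> /measurable_EFinP mf f0.
have f0' x : [set: borel_sphere R n] x -> (0 <= (f x)%:E)%E by rewrite lee_fin.
rewrite ge0_integral_mscale // ge0_integral_measure_add //.
by rewrite !integral_dirac // !diracT !mul1e -EFinD -EFinM mulrC.
Qed.

End antipodal.

Lemma energy_antipodal (R : realType) n (D : 'M[R]_n.+1) lmin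
    (z : sphere R n) (mu : probability (borel_sphere R n) R) :
  D^T = D -> eigenvector D lmin (sphere_val z) ->
  (forall A, measurable A -> mu A = antipodal z A) ->
  energy D mu = (cosh (- lmin))%:E.
Proof.
move=> sD [_ Dz] muz.
have int_mu (f : borel_sphere R n -> R) : measurable_fun setT f ->
    (forall x, 0 <= f x) ->
    (\int[mu]_x (f x)%:E = ((f z + f (sphere_opp z)) / 2)%:E)%E.
  move=> mf f0; rewrite -ge0_integral_antipodal //.
  by apply: eq_measure_integral => A mA _; exact: muz.
have mexp v : measurable_fun setT
    (fun x : borel_sphere R n => expR (dotp (sphere_val x) v)).
  exact: (measurableT_comp (@measurable_expR R) (measurable_linear v)).
have inner (y : borel_sphere R n) :
    (\int[mu]_x (expR (dotp (sphere_val x) (D *m sphere_val y)))%:E)%E =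
    ((expR (dotp (sphere_val y) (D *m sphere_val z)) +
      expR (dotp (sphere_val y) (D *m - sphere_val z))) / 2)%:E.
  rewrite int_mu //; rewrite {2}/sphere_val /= dotpNl mulmxN dotpNr.
  by rewrite (dotp_sym (sphere_val y) _ sD).
rewrite /energy; under eq_integral do rewrite inner.
rewrite int_mu; last 2 first.
- by apply: measurable_funM => //; apply: measurable_funD; exact: mexp.
- by move=> y; rewrite mulr_ge0 // addr_ge0.
rewrite [sphere_val (sphere_opp z)]/= mulmxN Dz !(dotpNl, dotpNr) opprK.
by rewrite !dotpZr dotp_sphere mulr1 /cosh opprK; congr EFin; field.
Qed.

(** On {z, - z}, every function f agrees with the affine function
    (f z + f (- z)) / 2 + (f z - f (- z)) / 2 * (x . z), whose integral is its
    constant term when the barycenter is orthogonal to z. This is applied to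
    indicator functions. *)
Lemma ae_antipodal_balanced (R : realType) n (z : sphere R n)
    (mu : probability (borel_sphere R n) R) :
  (\forall x \ae mu, x = z \/ x = sphere_opp z) ->
  dotp (barycenter mu) (sphere_val z) = 0 ->
  forall A, measurable A -> mu A = antipodal z A.
Proof.
move=> xz mz A mA; rewrite -[in LHS](setIT A) -integral_indic //.
pose p : R := \1_A (z : borel_sphere R n).
pose q : R := \1_A (sphere_opp z : borel_sphere R n).
transitivity (\int[mu]_x ((p + q) / 2 +
    (p - q) / 2 * dotp (sphere_val x) (sphere_val z))%:E)%E.
  apply: ae_eq_integral => //.
  - exact/measurable_EFinP.
  - apply/measurable_EFinP; apply: measurable_funD => //.
    by apply: measurable_funM => //; exact: measurable_linear.
  - apply: (@filterS _ _ (ae_filter_ringOfSetsType mu) _ _ _ xz) => x {}xz _.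
    congr EFin.
    case: xz => ->; rewrite -/p -/q ?[sphere_val (sphere_opp z)]/= ?dotpNl.
      by rewrite dotp_sphere; field.
    by rewrite dotp_sphere; field.
rewrite integral_affine mz mulr0 addr0 antipodalE mulrC EFinM EFinD.
by rewrite /p /q !indicE.
Qed.

(** * Characterization of the maximizers *)

Unset Implicit Arguments.

Theorem theorem3p17 (R : realType) (n : nat) (D : 'M[R]_n.+1) (lmin : R)
  (D_sym : D^T = D) (D_nsd : neg_semidefinite D)
  (lmin_eig : smallest_eigenvalue D lmin) (lmin_lt0 : lmin < 0)
  (mu : probability (borel_sphere R n) R) :
  maximizes_energy D mu <->
  exists z : sphere R n,
    eigenvector D lmin (sphere_val z) /\
    forall A : set (borel_sphere R n), measurable A ->
      mu A = ((2^-1)%:E *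
              (dirac (z : borel_sphere R n) A +
               dirac (sphere_opp z : borel_sphere R n) A))%E.
Proof.
have l0 : 0 < - lmin by rewrite oppr_gt0.
have Dl (x y : sphere R n) := nsd_form_bounded x y D_sym D_nsd lmin_eig.
split=> [maxmu|[z [Dz muz]] nu]; last first.
  rewrite (energy_antipodal (mu := mu) D_sym Dz).
    exact: (energy_le_cosh l0 D_sym Dl).
  by move=> A mA; rewrite antipodalE muz.
have [w Dw] := unit_eigenvector_exists D_sym lmin_eig.1.
have Emu : ((cosh (- lmin))%:E <= energy D mu)%E.
  by rewrite -(energy_antipodal (mu := antipodal w) D_sym Dw).
have [z sat] := energy_max_saturated l0 D_sym Dl D_nsd Emu.
have ext x := nsd_form_extremal D_sym D_nsd lmin_eig lmin_lt0 (x := x) (y := z).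
have [x /ext[Dz _]] := ae_ex sat.
exists z; split=> // A mA; rewrite -antipodalE.
apply: ae_antipodal_balanced mA.
  by apply: (@filterS _ _ (ae_filter_ringOfSetsType mu) _ _ _ sat) => y /ext[].
have := dotp_sym (barycenter mu) (sphere_val z) D_sym.
rewrite (energy_max_barycenter l0 D_sym Dl D_nsd Emu) dotp0 Dz.2 dotpZr.
by move/eqP; rewrite mulf_eq0 lt_eqF //= => /eqP.
Qed.
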